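(* Let $\delta\in(0,1)$ and let $f:G_\delta\to\mathbb{C}$ be a function. Suppose there are a Hilbert space $\mathcal{M}$, a unitary operator $U$ on $\mathcal{M}$ and a map $u:G_\delta\to\mathcal{M}$ such that for all $\lambda,\mu\in G_\delta$, $$1-\overline{f(\mu)}f(\lambda)=\langle(1-\mu_U^*\lambda_U)u(\lambda),u(\mu)\rangle_{\mathcal{M}}.$$ Then $f$ is holomorphic on $G_\delta$.
   Context: $G_\delta=\{x+iy: x,y\in\mathbb{R},\ \frac{x^2}{(1+\delta)^2}+\frac{y^2}{(1-\delta)^2}<1\}$. For $\lambda\in G_\delta$ and a unitary $U$ on $\mathcal{M}$, $\lambda_U=(\delta U^*-\tfrac12\lambda)(1-\tfrac12\lambda U^* )^{-1}$. *)

(* Defs.v *)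
From Stdlib Require Import Reals ClassicalEpsilon.
From Coquelicot Require Import Coquelicot.

Open Scope R_scope.

Definition G (delta : R) : C -> Prop :=
  fun z => (Re z)^2 / (1 + delta)^2 + (Im z)^2 / (1 - delta)^2 < 1.

Record Hilbert := {
  hcar :> CompleteNormedModule C_AbsRing;
  hinner : hcar -> hcar -> C;
  hinner_plus_l : forall x y z : hcar,
      hinner (plus x y) z = Cplus (hinner x z) (hinner y z);
  hinner_scal_l : forall (a : C) (x y : hcar),
      hinner (scal a x) y = Cmult a (hinner x y);
  hinner_conj : forall x y : hcar, hinner y x = Cconj (hinner x y);
  hinner_norm : forall x : hcar, norm x = sqrt (Re (hinner x x))
}.

Section Ops.
Variable M : Hilbert.

Definition unitary (U : M -> M) : Prop :=
  (forall x y : M, U (plus x y) = plus (U x) (U y)) /\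
  (forall (a : C) (x : M), U (scal a x) = scal a (U x)) /\
  (forall x y : M, hinner M (U x) (U y) = hinner M x y) /\
  (forall y : M, exists x : M, U x = y).

(* Hilbert-space adjoint Tstar : the operator with <T x, y> = <x, Tstar y>
   (chosen by description; it exists and is unique for bounded T). *)
Definition adj (T : M -> M) : M -> M :=
  fun y => epsilon (inhabits (zero : M))
             (fun z => forall x : M, hinner M (T x) y = hinner M x z).

(* Operator inverse A^{-1} (chosen by description; A bijective in our use). *)
Definition op_inv (A : M -> M) : M -> M :=
  fun x => epsilon (inhabits (zero : M)) (fun y => A y = x).

(* lambda_U = (delta Ustar - lambda/2) (1 - (lambda/2) Ustar)^{-1}, Ustar = adjoint of U *)
Definition lamU (delta : R) (U : M -> M) (lam : C) : M -> M :=
  fun x =>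
    let y := op_inv (fun v => minus v (scal (Cmult lam (RtoC (Rinv 2))) (adj U v))) x in
    minus (scal (RtoC delta) (adj U y)) (scal (Cmult lam (RtoC (Rinv 2))) y).

End Ops.

Definition holomorphic_on (D : C -> Prop) (f : C -> C) : Prop :=
  forall z, D z -> ex_derive (K := C_AbsRing) (V := C_NormedModule) f z.

(* Main.v *)
(* Put [c = lam/2] and [z(lam) = (1 - c U^* )^-1 u(lam)], so that [u = z - c U^* z] and
   [lam_U u = delta U^* z - c z].  The hypothesis says that the kernel
   [<u(a), u(b)> - <lam_U u(a), lam_U u(b)>] equals [1 - conj (f b) f a]; on combinations
   whose coefficients sum to zero it therefore yields
   [|sum k f|^2 + |sum k u|^2 = |sum k lam_U u|^2].
   The ellipse [G_delta] is exactly the set where [2 |c - delta conj c| < 1 - delta^2], which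
   makes [(delta U^* - c0) (1 - c0 U^* )^-1] a strict contraction for [c0 = lam0/2].
   Comparing both sides with their values at the frozen coefficient [c0] bounds the
   combinations by the variation of [c], i.e. by [|lam - lam0|]: with two points this gives
   Lipschitz continuity of [z] at [lam0], and then the difference quotients of [f] at [lam0]
   form a Cauchy family, so [f] is complex differentiable there. *)

Require Import Defs.
From Stdlib Require Import Reals Lra Lia Psatz ClassicalEpsilon Classical_Prop.
From Coquelicot Require Import Coquelicot.

Section GeometricIncrements.

Context {K : AbsRing} {V : NormedModule K}.

Lemma norm_minus_sym (x y : V) : norm (minus x y) = norm (minus y x).
Proof. now rewrite <- norm_opp, opp_minus. Qed.

Lemma norm_minus_diag (x : V) : norm (minus x x) = 0.
Proof. rewrite minus_eq_zero. apply norm_zero. Qed.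

Lemma norm_minus_le (x y : V) : norm (minus x y) <= norm x + norm y.
Proof. unfold minus. rewrite <- (norm_opp y). apply norm_triangle. Qed.

Lemma geometric_increments_tail (s : nat -> V) (q c : R) :
  0 <= q < 1 -> (forall n, norm (minus (s (S n)) (s n)) <= c * q ^ n) ->
  forall n k, norm (minus (s (n + k)%nat) (s n)) <= c * q ^ n / (1 - q).
Proof.
  intros Hq Hs n k.
  assert (Hc : 0 <= c).
  { specialize (Hs O). pose proof (norm_ge_0 (minus (s 1%nat) (s O))). simpl in Hs. lra. }
  assert (Hqn : 0 <= q ^ n) by (apply pow_le; lra).
  enough (H : norm (minus (s (n + k)%nat) (s n)) <= c * q ^ n * (1 - q ^ k) / (1 - q)).
  { eapply Rle_trans; [exact H|]. unfold Rdiv. apply Rmult_le_compat_r.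
    - apply Rlt_le, Rinv_0_lt_compat. lra.
    - pose proof (pow_le q k (proj1 Hq)). pose proof (Rmult_le_pos _ _ Hc Hqn). nra. }
  induction k as [|k IH].
  - rewrite Nat.add_0_r, norm_minus_diag. apply Req_le. simpl. field. lra.
  - rewrite Nat.add_succ_r, (minus_trans (s (n + k)%nat)).
    eapply Rle_trans; [apply norm_triangle|].
    specialize (Hs (n + k)%nat). rewrite pow_add in Hs.
    replace (c * q ^ n * (1 - q ^ S k) / (1 - q))
      with (c * (q ^ n * q ^ k) + c * q ^ n * (1 - q ^ k) / (1 - q)) by (simpl; field; lra).
    lra.
Qed.

End GeometricIncrements.

Section Contraction.

Context {K : AbsRing} {V : CompleteNormedModule K}.

Lemma geometric_increments_cvg (s : nat -> V) (q c : R) :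
  0 <= q < 1 -> (forall n, norm (minus (s (S n)) (s n)) <= c * q ^ n) ->
  exists l, filterlim s eventually (locally l).
Proof.
  intros Hq Hs. apply (proj1 (filterlim_locally_cauchy (F := eventually) (U := V) s)). intros eps.
  assert (Heps : 0 < eps * (1 - q) / (Rabs c + 1)).
  { apply Rdiv_lt_0_compat; [apply Rmult_lt_0_compat|]; pose proof (Rabs_pos c);
      destruct eps; simpl; lra. }
  assert (Hq1 : Rabs q < 1) by (rewrite Rabs_pos_eq; lra).
  destruct (pow_lt_1_zero q Hq1 _ Heps) as [N HN].
  assert (Htail : forall n k, (N <= n)%nat -> norm (minus (s (n + k)%nat) (s n)) < eps).
  { intros n k Hn. eapply Rle_lt_trans; [apply (geometric_increments_tail s q c Hq Hs)|].
    specialize (HN n Hn). rewrite Rabs_pos_eq in HN by (apply pow_le; lra).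
    pose proof (Rle_abs c). pose proof (pow_le q n (proj1 Hq)).
    apply Rmult_lt_compat_r with (r := Rabs c + 1) in HN; [|pose proof (Rabs_pos c); lra].
    unfold Rdiv in *. rewrite Rmult_assoc, Rinv_l in HN by (pose proof (Rabs_pos c); lra).
    apply Rmult_lt_reg_r with (r := 1 - q); [lra|].
    rewrite Rmult_assoc, Rinv_l by lra. nra. }
  exists (fun n => (N <= n)%nat). split; [now exists N|].
  intros m n Hm Hn. apply (@norm_compat1 K V).
  destruct (Nat.le_ge_cases m n) as [Hmn|Hmn].
  - replace n with (m + (n - m))%nat by lia. now apply Htail.
  - rewrite norm_minus_sym. replace m with (n + (m - n))%nat by lia. now apply Htail.
Qed.

Lemma contraction_has_fixed_point (T : V -> V) (q : R) :
  0 <= q < 1 -> (forall x y, norm (minus (T x) (T y)) <= q * norm (minus x y)) ->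
  exists x, T x = x.
Proof.
  intros Hq HT.
  set (s := fun n => Nat.iter n T zero).
  assert (Hs : forall n, norm (minus (T (s n)) (s n)) <= norm (minus (T zero) zero) * q ^ n).
  { induction n as [|n IH].
    - simpl. rewrite Rmult_1_r. apply Rle_refl.
    - eapply Rle_trans; [exact (HT (s (S n)) (s n))|].
      change (s (S n)) with (T (s n)). change (q ^ S n) with (q * q ^ n).
      replace (norm (minus (T zero) zero) * (q * q ^ n))
        with (q * (norm (minus (T zero) zero) * q ^ n)) by ring.
      apply Rmult_le_compat_l; lra. }
  destruct (geometric_increments_cvg s q _ Hq Hs) as [x Hx].
  exists x. apply ball_norm_eq. intros eps.
  destruct (proj1 (filterlim_locally_ball_norm _ _) Hx (pos_div_2 eps)) as [N HN].
  unfold ball_norm in *. simpl in HN.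
  rewrite (minus_trans (s (S N))).
  eapply Rle_lt_trans; [apply (@norm_triangle K V)|].
  rewrite (@norm_minus_sym K V x).
  pose proof (HN (S N) ltac:(lia)) as Hnext. pose proof (HN N ltac:(lia)) as Hcur.
  eapply Rlt_le_trans; [apply Rplus_lt_le_compat; [exact Hnext | apply HT]|].
  eapply Rle_trans; [apply Rplus_le_compat_l, Rmult_le_compat_l; [lra | apply Rlt_le; exact Hcur]|].
  destruct eps; simpl. nra.
Qed.

End Contraction.

Local Open Scope C_scope.

Lemma Cconj_RtoC (r : R) : Cconj (RtoC r) = RtoC r.
Proof. apply injective_projections; simpl; ring. Qed.

#[local] Hint Rewrite Cplus_conj Cminus_conj Copp_conj Cmult_conj Cconj_conj Cconj_RtoC : Cconj.

Section InnerProduct.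

Context {M : Hilbert}.
Implicit Types x y z : M.

Lemma hinner_plus_r x y z : hinner M z (plus x y) = hinner M z x + hinner M z y.
Proof. now rewrite hinner_conj, hinner_plus_l, Cplus_conj, <- !hinner_conj. Qed.

Lemma hinner_scal_r (a : C) x y : hinner M y (scal a x) = Cconj a * hinner M y x.
Proof. now rewrite hinner_conj, hinner_scal_l, Cmult_conj, <- hinner_conj. Qed.

Lemma hinner_opp_l x y : hinner M (opp x) y = - hinner M x y.
Proof.
  replace (opp x) with (scal (- RtoC 1) x) by apply (@scal_opp_one C_AbsRing M).
  rewrite hinner_scal_l. ring.
Qed.

Lemma hinner_opp_r x y : hinner M y (opp x) = - hinner M y x.
Proof. now rewrite hinner_conj, hinner_opp_l, Copp_conj, <- hinner_conj. Qed.

Lemma hinner_minus_l x y z : hinner M (minus x y) z = hinner M x z - hinner M y z.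
Proof. unfold minus. now rewrite hinner_plus_l, hinner_opp_l. Qed.

Lemma hinner_minus_r x y z : hinner M z (minus x y) = hinner M z x - hinner M z y.
Proof. unfold minus. now rewrite hinner_plus_r, hinner_opp_r. Qed.

Lemma hinner_zero_l y : hinner M zero y = 0.
Proof.
  replace (@zero M) with (scal (RtoC 0) (@zero M)) by apply (@scal_zero_l C_AbsRing M).
  rewrite hinner_scal_l. ring.
Qed.

Lemma hinner_zero_r y : hinner M y zero = 0.
Proof. rewrite hinner_conj, hinner_zero_l. apply injective_projections; simpl; ring. Qed.

End InnerProduct.

#[local] Hint Rewrite @hinner_plus_l @hinner_plus_r @hinner_minus_l @hinner_minus_r
  @hinner_opp_l @hinner_opp_r @hinner_scal_l @hinner_scal_r @hinner_zero_l @hinner_zero_r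
  : hinner.

Section InnerProductGeometry.

Context {M : Hilbert}.
Implicit Types x y : M.

Lemma hinner_self x : hinner M x x = RtoC (norm x ^ 2).
Proof.
  assert (Him : Im (hinner M x x) = 0%R).
  { pose proof (f_equal Im (hinner_conj M x x)) as H. rewrite im_conj in H. lra. }
  assert (Hre : (0 <= Re (hinner M x x))%R).
  { destruct (Rle_or_lt 0 (Re (hinner M x x))) as [h|h]; [easy|].
    assert (Hx : x = zero).
    { apply (@norm_eq_zero C_AbsRing M). rewrite hinner_norm. apply sqrt_neg_0. lra. }
    rewrite Hx, hinner_zero_l in h. simpl in h. lra. }
  rewrite hinner_norm, pow2_sqrt by easy.
  destruct (hinner M x x) as [a b]. unfold Re, Im in *. simpl in *. now subst.
Qed.

Lemma eq_of_hinner_self_minus x y : hinner M (minus x y) (minus x y) = 0 -> x = y.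
Proof.
  rewrite hinner_self. intros E. apply (f_equal Re) in E. simpl in E.
  assert (Hn : norm (minus x y) = 0%R) by nra.
  symmetry. apply (@ball_norm_eq C_AbsRing M). intros eps.
  eapply Rle_lt_trans; [apply Req_le; exact Hn | apply cond_pos].
Qed.

Lemma hinner_ext_l x y : (forall z, hinner M x z = hinner M y z) -> x = y.
Proof.
  intros H. apply eq_of_hinner_self_minus. rewrite hinner_minus_l, H. ring.
Qed.

Lemma hinner_ext_r x y : (forall z, hinner M z x = hinner M z y) -> x = y.
Proof.
  intros H. apply hinner_ext_l. intros z. now rewrite (hinner_conj M z x), (hinner_conj M z y), H.
Qed.

Lemma Re_hinner_le x y : (Re (hinner M x y) <= norm x * norm y)%R.
Proof.
  assert (E : hinner M (plus x y) (plus x y) =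
     hinner M x x + hinner M y y + (hinner M x y + Cconj (hinner M x y))).
  { autorewrite with hinner. rewrite (hinner_conj M x y). ring. }
  rewrite !hinner_self in E. apply (f_equal Re) in E.
  destruct (hinner M x y) as [p q]. simpl in E |- *.
  pose proof (@norm_triangle C_AbsRing M x y) as Htri.
  pose proof (@norm_ge_0 C_AbsRing M x). pose proof (@norm_ge_0 C_AbsRing M y).
  pose proof (Rmult_le_compat _ _ _ _ (@norm_ge_0 C_AbsRing M (plus x y))
                (@norm_ge_0 C_AbsRing M (plus x y)) Htri Htri).
  nra.
Qed.

End InnerProductGeometry.

Ltac hinner_ring := apply hinner_ext_l; intro; autorewrite with hinner; ring.

Section Isometry.

Context {M : Hilbert} (W : M -> M).
Hypothesis W_hinner : forall x y, hinner M (W x) (W y) = hinner M x y.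

Lemma isometry_norm x : norm (W x) = norm x.
Proof.
  pose proof (W_hinner x x) as H. rewrite !hinner_self in H. apply (f_equal Re) in H. simpl in H.
  pose proof (@norm_ge_0 C_AbsRing M x). pose proof (@norm_ge_0 C_AbsRing M (W x)). nra.
Qed.

Lemma isometry_minus x y : W (minus x y) = minus (W x) (W y).
Proof.
  apply eq_of_hinner_self_minus.
  autorewrite with hinner. rewrite !W_hinner. autorewrite with hinner. ring.
Qed.

Lemma norm_minus_scal_isometry_ge (a : C) x :
  ((1 - Cmod a) * norm x <= norm (minus x (scal a (W x))))%R.
Proof.
  pose proof (Rle_trans _ _ _ (Rle_abs _) (@norm_triangle_inv C_AbsRing M x (scal a (W x)))).
  pose proof (@norm_scal C_AbsRing M a (W x)) as Hscal. rewrite isometry_norm in Hscal.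
  assert (norm (scal a (W x)) <= Cmod a * norm x)%R by exact Hscal. lra.
Qed.

Lemma isometry_resolvent_surjective (a : C) : (Cmod a < 1)%R ->
  forall x, exists y, minus y (scal a (W y)) = x.
Proof.
  intros Ha x.
  destruct (contraction_has_fixed_point (fun y => plus x (scal a (W y))) (Cmod a)) as [y Hy].
  - split; [apply Cmod_ge_0 | exact Ha].
  - intros y y'.
    replace (minus (plus x (scal a (W y))) (plus x (scal a (W y'))))
      with (scal a (W (minus y y'))) by (rewrite isometry_minus; hinner_ring).
    rewrite <- (isometry_norm (minus y y')). apply (@norm_scal C_AbsRing M).
  - exists y. rewrite <- Hy at 1. hinner_ring.
Qed.

End Isometry.

Section Adjoint.

Context {M : Hilbert}.

Definition has_adjoint (T : M -> M) : Prop :=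
  forall y, exists z, forall x, hinner M (T x) y = hinner M x z.

Lemma adj_spec (T : M -> M) : has_adjoint T ->
  forall x y, hinner M (T x) y = hinner M x (adj M T y).
Proof.
  intros HT x y. revert x. unfold adj.
  apply (epsilon_spec (inhabits zero) (fun z => forall x, hinner M (T x) y = hinner M x z)).
  apply HT.
Qed.

Lemma hinner_adj_l (T : M -> M) : has_adjoint T ->
  forall x y, hinner M (adj M T x) y = hinner M x (T y).
Proof.
  intros HT x y. now rewrite hinner_conj, <- adj_spec, <- hinner_conj.
Qed.

Lemma op_inv_spec (A : M -> M) : (forall x, exists y, A y = x) ->
  forall x, A (op_inv M A x) = x.
Proof.
  intros HA x. unfold op_inv.
  apply (epsilon_spec (inhabits zero) (fun y => A y = x)). apply HA.
Qed.

Section Unitary.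

Variable U : M -> M.
Hypothesis hU : unitary M U.

Lemma unitary_has_adjoint : has_adjoint U.
Proof.
  destruct hU as (_ & _ & U_hinner & U_surj).
  intros y. destruct (U_surj y) as [z <-]. exists z. intros x. apply U_hinner.
Qed.

Lemma unitary_adj_hinner x y : hinner M (adj M U x) (adj M U y) = hinner M x y.
Proof.
  destruct hU as (_ & _ & U_hinner & U_surj).
  assert (U_adj : forall y, U (adj M U y) = y).
  { intros z. apply hinner_ext_r. intros w. destruct (U_surj w) as [v <-].
    now rewrite U_hinner, adj_spec by exact unitary_has_adjoint. }
  now rewrite <- U_hinner, !U_adj.
Qed.

End Unitary.

End Adjoint.

Definition half (lam : C) : C := Cmult lam (RtoC (Rinv 2)).

Section LambdaU.

Context {M : Hilbert} (U : M -> M) (delta : R) (lam : C).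
Hypothesis hU : unitary M U.
Hypothesis half_lt_1 : (Cmod (half lam) < 1)%R.

Definition resolvent : M -> M :=
  op_inv M (fun v => minus v (scal (half lam) (adj M U v))).

Lemma resolvent_spec x :
  minus (resolvent x) (scal (half lam) (adj M U (resolvent x))) = x.
Proof.
  apply (op_inv_spec (fun v => minus v (scal (half lam) (adj M U v)))).
  apply isometry_resolvent_surjective; [exact (unitary_adj_hinner U hU) | exact half_lt_1].
Qed.

Lemma lamU_resolvent x : lamU M delta U lam x =
  minus (scal (RtoC delta) (adj M U (resolvent x))) (scal (half lam) (resolvent x)).
Proof. reflexivity. Qed.

(* The adjoint is [(1 - conj c U)^-1 (delta U - conj c)], with [c = lam/2]. *)
Lemma lamU_has_adjoint : has_adjoint (lamU M delta U lam).
Proof.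
  pose proof hU as (_ & _ & U_hinner & _).
  intros y.
  destruct (isometry_resolvent_surjective U U_hinner (Cconj (half lam))
              ltac:(now rewrite Cmod_conj)
              (minus (scal (RtoC delta) (U y)) (scal (Cconj (half lam)) y))) as [r Hr].
  exists r. intros x.
  rewrite lamU_resolvent. set (s := resolvent x).
  rewrite <- (resolvent_spec x). fold s.
  apply (f_equal (hinner M s)) in Hr.
  autorewrite with hinner in Hr |- *.
  autorewrite with Cconj in Hr.
  rewrite !(hinner_adj_l U (unitary_has_adjoint U hU)), Hr.
  ring.
Qed.

End LambdaU.

Local Close Scope C_scope.

Lemma G_half_ellipse (delta : R) (lam : C) : 0 < delta < 1 -> G delta lam ->
  2 * Cmod (half lam - RtoC delta * Cconj (half lam))%C < 1 - delta ^ 2.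
Proof.
  intros Hd HG. set (m := 2 * Cmod (half lam - RtoC delta * Cconj (half lam))%C).
  assert (Hm0 : 0 <= m) by (unfold m; pose proof (Cmod_ge_0 (half lam - RtoC delta * Cconj (half lam))%C); lra).
  assert (Em : m ^ 2 = (1 - delta) ^ 2 * Re lam ^ 2 + (1 + delta) ^ 2 * Im lam ^ 2).
  { unfold m. rewrite Rpow_mult_distr, Cmod2_alt. unfold half.
    destruct lam as [x y]. unfold Re, Im. simpl. field. }
  assert (HG2 : m ^ 2 < (1 - delta ^ 2) ^ 2).
  { rewrite Em. unfold G in HG.
    apply Rmult_lt_compat_l with (r := (1 - delta) ^ 2 * (1 + delta) ^ 2) in HG;
      [|apply Rmult_lt_0_compat; apply pow_lt; lra].
    replace ((1 - delta) ^ 2 * (1 + delta) ^ 2 * (Re lam ^ 2 / (1 + delta) ^ 2 + Im lam ^ 2 / (1 - delta) ^ 2))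
      with ((1 - delta) ^ 2 * Re lam ^ 2 + (1 + delta) ^ 2 * Im lam ^ 2) in HG by (field; lra).
    nra. }
  assert (Hd2 : 0 < 1 - delta ^ 2) by nra.
  destruct (Rlt_or_le m (1 - delta ^ 2)) as [Hlt|Hle]; [exact Hlt|].
  pose proof (Rmult_le_compat _ _ _ _ (Rlt_le _ _ Hd2) (Rlt_le _ _ Hd2) Hle Hle). nra.
Qed.

Lemma Cmod_half_minus (a b : C) : Cmod (half a - half b)%C = Cmod (a - b)%C / 2.
Proof.
  unfold half. replace (a * RtoC (/ 2) - b * RtoC (/ 2))%C with ((a - b) * RtoC (/ 2))%C by ring.
  rewrite Cmod_mult, Cmod_R, Rabs_pos_eq by lra. lra.
Qed.

Lemma Cmod_lt_1_of_ellipse (delta : R) (c : C) : 0 < delta < 1 ->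
  2 * Cmod (c - RtoC delta * Cconj c)%C < 1 - delta ^ 2 -> Cmod c < 1.
Proof.
  intros Hd Hc.
  assert (Htri : Cmod c <= Cmod (c - RtoC delta * Cconj c)%C + delta * Cmod c).
  { replace c with ((c - RtoC delta * Cconj c) + RtoC delta * Cconj c)%C at 1 by ring.
    eapply Rle_trans; [apply Cmod_triangle|].
    rewrite Cmod_mult, Cmod_R, Cmod_conj, Rabs_pos_eq by lra. lra. }
  nra.
Qed.

Lemma G_half_lt_1 (delta : R) (lam : C) : 0 < delta < 1 -> G delta lam -> Cmod (half lam) < 1.
Proof.
  intros Hd HG. exact (Cmod_lt_1_of_ellipse delta _ Hd (G_half_ellipse delta lam Hd HG)).
Qed.

(* For [q = 1] the inequality below is exactly the strict ellipse condition, so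
   it survives for some [q < 1]. *)
Lemma contraction_constant (delta : R) (c : C) : 0 < delta < 1 ->
  2 * Cmod (c - RtoC delta * Cconj c)%C < 1 - delta ^ 2 ->
  exists q, 0 <= q < 1 /\
    2 * Cmod (RtoC q * c - RtoC delta * Cconj c)%C <= q * (1 + Cmod c ^ 2) - delta ^ 2 - Cmod c ^ 2.
Proof.
  intros Hd Hc. pose proof (Cmod_lt_1_of_ellipse delta c Hd Hc) as Hc1.
  set (m := 2 * Cmod (c - RtoC delta * Cconj c)%C) in *.
  assert (Hm : 0 <= m) by (unfold m; pose proof (Cmod_ge_0 (c - RtoC delta * Cconj c)%C); lra).
  set (g := 1 - delta ^ 2 - m).
  exists (1 - g / 4). split; [unfold g; nra|].
  assert (Htri : Cmod (RtoC (1 - g / 4) * c - RtoC delta * Cconj c)%C <= m / 2 + g / 4 * Cmod c).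
  { replace (RtoC (1 - g / 4) * c - RtoC delta * Cconj c)%C
      with ((c - RtoC delta * Cconj c) + (- RtoC (g / 4)) * c)%C by (rewrite RtoC_minus; ring).
    eapply Rle_trans; [apply Cmod_triangle|].
    rewrite Cmod_mult, Cmod_opp, Cmod_R, Rabs_pos_eq by (unfold g; lra). unfold m. lra. }
  pose proof (Cmod_ge_0 c).
  assert (Hg : 0 < g) by (unfold g; lra).
  assert (Hc4 : (1 + Cmod c) ^ 2 <= 4) by nra.
  assert (g / 4 * (1 + Cmod c) ^ 2 <= g) by (apply Rmult_le_compat_l with (r := g / 4) in Hc4; lra).
  unfold g in *. nra.
Qed.

Lemma sqr_le_of_Rabs_sub_lt (x x0 rho : R) : Rabs (x - x0) < rho -> rho <= 1 ->
  x ^ 2 <= x0 ^ 2 + rho * (2 * Rabs x0 + 1).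
Proof.
  intros H1 H2. set (d := x - x0) in *. replace x with (x0 + d) by (unfold d; ring).
  assert (d * d <= Rabs d).
  { replace (d * d) with (Rabs d * Rabs d) by (rewrite <- Rabs_mult; apply Rabs_pos_eq; nra).
    pose proof (Rabs_pos d). nra. }
  assert (x0 * d <= Rabs x0 * rho).
  { eapply Rle_trans; [apply Rle_abs|]. rewrite Rabs_mult.
    apply Rmult_le_compat_l; [apply Rabs_pos | lra]. }
  nra.
Qed.

Lemma G_open_ball (delta : R) (z0 : C) : 0 < delta < 1 -> G delta z0 ->
  exists rho, 0 < rho /\ forall z, Cmod (z - z0)%C < rho -> G delta z.
Proof.
  unfold G. intros Hd H.
  set (ia := / (1 + delta) ^ 2). set (ib := / (1 - delta) ^ 2).
  assert (Hia : 0 < ia) by (apply Rinv_0_lt_compat; nra).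
  assert (Hib : 0 < ib) by (apply Rinv_0_lt_compat; nra).
  unfold Rdiv in H. fold ia ib in H.
  set (s := Re z0 ^ 2 * ia + Im z0 ^ 2 * ib) in *.
  set (K := (2 * Rabs (Re z0) + 1) * ia + (2 * Rabs (Im z0) + 1) * ib).
  assert (HK : 0 < K).
  { unfold K. pose proof (Rabs_pos (Re z0)). pose proof (Rabs_pos (Im z0)). nra. }
  exists (Rmin 1 ((1 - s) / (2 * K))). split.
  { apply Rmin_pos; [lra | apply Rdiv_lt_0_compat; lra]. }
  intros z Hz. unfold Rdiv. fold ia ib.
  set (rho := Rmin 1 ((1 - s) / (2 * K))) in *.
  assert (r1 : rho <= 1) by apply Rmin_l.
  assert (r2 : rho <= (1 - s) / (2 * K)) by apply Rmin_r.
  pose proof (Rmax_Cmod (z - z0)%C) as HM.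
  assert (Hx : Rabs (Re z - Re z0) < rho).
  { eapply Rle_lt_trans; [|exact Hz]. eapply Rle_trans; [|exact HM]. apply Rmax_l. }
  assert (Hy : Rabs (Im z - Im z0) < rho).
  { eapply Rle_lt_trans; [|exact Hz]. eapply Rle_trans; [|exact HM]. apply Rmax_r. }
  apply sqr_le_of_Rabs_sub_lt in Hx; [|exact r1]. apply sqr_le_of_Rabs_sub_lt in Hy; [|exact r1].
  assert (Re z ^ 2 * ia <= (Re z0 ^ 2 + rho * (2 * Rabs (Re z0) + 1)) * ia)
    by (apply Rmult_le_compat_r; lra).
  assert (Im z ^ 2 * ib <= (Im z0 ^ 2 + rho * (2 * Rabs (Im z0) + 1)) * ib)
    by (apply Rmult_le_compat_r; lra).
  assert (rho * K <= (1 - s) / 2).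
  { replace ((1 - s) / 2) with ((1 - s) / (2 * K) * K) by (field; lra).
    apply Rmult_le_compat_r; lra. }
  unfold K in *. unfold s in *. nra.
Qed.

Lemma lamU_contraction_sq {M : Hilbert} (V : M -> M)
  (V_hinner : forall x y, hinner M (V x) (V y) = hinner M x y)
  (delta q : R) (c : C) (Z : M) :
  2 * Cmod (RtoC q * c - RtoC delta * Cconj c)%C <= q * (1 + Cmod c ^ 2) - delta ^ 2 - Cmod c ^ 2 ->
  norm (minus (scal (RtoC delta) (V Z)) (scal c Z)) ^ 2 <= q * norm (minus Z (scal c (V Z))) ^ 2.
Proof.
  intros Hq.
  set (beta := (RtoC q * c - RtoC delta * Cconj c)%C) in *.
  set (K := q * (1 + Cmod c ^ 2) - delta ^ 2 - Cmod c ^ 2) in *.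
  assert (E : (RtoC q * hinner M (minus Z (scal c (V Z))) (minus Z (scal c (V Z)))
              - hinner M (minus (scal (RtoC delta) (V Z)) (scal c Z))
                         (minus (scal (RtoC delta) (V Z)) (scal c Z))
            = RtoC K * hinner M Z Z
              - (hinner M (scal beta (V Z)) Z + Cconj (hinner M (scal beta (V Z)) Z)))%C).
  { unfold K, beta. autorewrite with hinner. rewrite V_hinner, (hinner_conj M (V Z) Z).
    rewrite !RtoC_minus, !RtoC_mult, !RtoC_plus, !Cmod2_conj, !RtoC_pow.
    autorewrite with Cconj. ring. }
  rewrite !hinner_self in E.
  pose proof (Re_hinner_le (scal beta (V Z)) Z) as CS.
  pose proof (@norm_scal C_AbsRing M beta (V Z)) as NS. rewrite (isometry_norm V V_hinner) in NS.
  destruct (hinner M (scal beta (V Z)) Z) as [h1 h2].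
  apply (f_equal Re) in E. simpl in E, CS.
  pose proof (@norm_ge_0 C_AbsRing M Z). pose proof (Cmod_ge_0 beta).
  assert (h1 <= Cmod beta * norm Z * norm Z) by (eapply Rle_trans; [apply CS | apply Rmult_le_compat_r; auto]).
  assert (2 * Cmod beta * (norm Z * norm Z) <= K * (norm Z * norm Z))
    by (apply Rmult_le_compat_r; [apply Rmult_le_pos|]; auto).
  nra.
Qed.

Lemma lamU_contraction (delta : R) (c : C) : 0 < delta < 1 ->
  2 * Cmod (c - RtoC delta * Cconj c)%C < 1 - delta ^ 2 ->
  exists r, 0 <= r < 1 /\
    forall (M : Hilbert) (V : M -> M), (forall x y, hinner M (V x) (V y) = hinner M x y) ->
    forall Z : M, norm (minus (scal (RtoC delta) (V Z)) (scal c Z)) <= r * norm (minus Z (scal c (V Z))).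
Proof.
  intros Hd Hc. destruct (contraction_constant delta c Hd Hc) as [q [Hq Hqc]].
  exists (sqrt q). split.
  { split; [apply sqrt_pos|]. rewrite <- sqrt_1. apply sqrt_lt_1; lra. }
  intros M V V_hinner Z.
  pose proof (lamU_contraction_sq V V_hinner delta q c Z Hqc) as H.
  pose proof (@norm_ge_0 C_AbsRing M (minus (scal (RtoC delta) (V Z)) (scal c Z))) as Ha.
  pose proof (@norm_ge_0 C_AbsRing M (minus Z (scal c (V Z)))) as Hb.
  rewrite <- (sqrt_pow2 _ Ha), <- (sqrt_pow2 _ Hb), <- sqrt_mult by (lra || apply pow2_ge_0).
  apply sqrt_le_1_alt. exact H.
Qed.

Lemma pythagoras_estimates (a e F X Y r : R) : 0 <= F -> 0 <= X -> 0 <= Y -> 0 <= r < 1 ->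
  F ^ 2 + X ^ 2 = Y ^ 2 -> a - e <= X -> Y <= r * a + e ->
  a <= 2 * e / (1 - r) /\ F <= r * a + e.
Proof.
  intros HF HX HY Hr E HaX HY'.
  assert (X <= Y) by nra. assert (F <= Y) by nra.
  split; [|lra].
  apply Rmult_le_reg_r with (r := 1 - r); [lra|].
  unfold Rdiv. rewrite Rmult_assoc, Rinv_l by lra. lra.
Qed.

Local Open Scope C_scope.

Definition diff_quot (f : C -> C) (z0 l : C) : C := (f l - f z0) / (l - z0).

Lemma locally'_proper_C (z0 : C) : ProperFilter (@locally' C_UniformSpace z0).
Proof.
  constructor; [|apply within_filter, locally_filter].
  intros P [eps HP]. exists (z0 + RtoC (eps / 2)). apply HP.
  - apply C_NormedModule_mixin_compat1. change (Cmod (z0 + RtoC (eps / 2) - z0) < eps)%R.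
    replace (z0 + RtoC (eps / 2) - z0) with (RtoC (eps / 2)) by ring.
    rewrite Cmod_R, Rabs_pos_eq; destruct eps; simpl; lra.
  - intros H. assert (E : RtoC (eps / 2) = 0).
    { replace (RtoC (eps / 2)) with ((z0 + RtoC (eps / 2)) - z0) by ring. rewrite H. ring. }
    injection E. destruct eps; simpl; lra.
Qed.

Lemma diff_quot_cvg (f : C -> C) (z0 : C) (rho K : R) : (0 < rho)%R ->
  (forall l l', (0 < Cmod (l - z0) < rho)%R -> (0 < Cmod (l' - z0) < rho)%R ->
     (Cmod (diff_quot f z0 l - diff_quot f z0 l') <= K * (Cmod (l - z0) + Cmod (l' - z0)))%R) ->
  exists L, filterlim (diff_quot f z0) (locally' z0) (locally L).
Proof.
  intros Hrho HD.
  apply (proj1 (@filterlim_locally_cauchy C_UniformSpace C_CompleteNormedModule _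
                  (locally'_proper_C z0) (diff_quot f z0))).
  intros eps. set (K' := Rmax K 0).
  set (d := Rmin rho (eps / (2 * K' + 1))).
  assert (HK' : (0 <= K')%R) by apply Rmax_r.
  assert (Hd : (0 < d)%R).
  { apply Rmin_pos; [easy|]. apply Rdiv_lt_0_compat; [destruct eps; simpl; lra | lra]. }
  exists (fun l => (0 < Cmod (l - z0) < d)%R). split.
  - unfold locally', within.
    apply filter_imp with (P := ball_norm z0 d); [|apply (locally_ball_norm z0 (mkposreal d Hd))].
    intros l Hl Hne. split; [|exact Hl].
    now apply Cmod_gt_0, Cminus_eq_contra.
  - intros a b Ha Hb. apply C_NormedModule_mixin_compat1.
    change (Cmod (diff_quot f z0 b - diff_quot f z0 a) < eps)%R.
    assert (d <= rho)%R by apply Rmin_l.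
    assert (Hde : (d <= eps / (2 * K' + 1))%R) by apply Rmin_r.
    eapply Rle_lt_trans; [apply HD; lra|].
    assert (HKK : (K <= K')%R) by apply Rmax_l.
    pose proof (Cmod_ge_0 (b - z0)). pose proof (Cmod_ge_0 (a - z0)).
    apply Rmult_le_compat_l with (r := (2 * K')%R) in Hde; [|lra].
    replace (2 * K' * (eps / (2 * K' + 1)))%R with (eps * (2 * K' / (2 * K' + 1)))%R in Hde
      by (field; lra).
    assert (2 * K' / (2 * K' + 1) < 1)%R.
    { apply Rmult_lt_reg_r with (r := (2 * K' + 1)%R); [lra|].
      unfold Rdiv. rewrite Rmult_assoc, Rinv_l by lra. lra. }
    destruct eps as [e He]; simpl in *. nra.
Qed.

Lemma is_derive_of_diff_quot_cvg (f : C -> C) (z0 L : C) :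
  filterlim (diff_quot f z0) (locally' z0) (locally L) ->
  is_derive (K := C_AbsRing) (V := C_NormedModule) f z0 L.
Proof.
  intros HL. split; [apply is_linear_scal_l|].
  intros x Hx.
  pose proof (@is_filter_lim_locally_unique C_AbsRing (AbsRing_NormedModule C_AbsRing) z0 x Hx).
  subst x. intros eps.
  destruct (proj1 (filterlim_locally_ball_norm _ _) HL eps) as [d Hd].
  exists d. intros y Hy.
  change (Cmod ((f y - f z0) - (y - z0) * L) <= eps * Cmod (y - z0))%R.
  destruct (classic (y = z0)) as [->|Hne].
  - replace ((f z0 - f z0) - (z0 - z0) * L) with (RtoC 0) by ring.
    rewrite Cmod_0. pose proof (Cmod_ge_0 (z0 - z0)). pose proof (cond_pos eps). nra.
  - pose proof (Cminus_eq_contra _ _ Hne) as Hyz.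
    specialize (Hd y (C_NormedModule_mixin_compat1 _ _ _ Hy) Hne).
    change (Cmod (diff_quot f z0 y - L) < eps)%R in Hd.
    replace ((f y - f z0) - (y - z0) * L) with ((y - z0) * (diff_quot f z0 y - L))
      by (unfold diff_quot; field; exact Hyz).
    rewrite Cmod_mult, Rmult_comm. apply Rmult_le_compat_r; [apply Cmod_ge_0 | lra].
Qed.

Definition comb3 {M : Hilbert} (k1 k2 : C) (x1 x2 x3 : M) : M :=
  plus (plus (scal k1 x1) (scal k2 x2)) (scal (- (k1 + k2)) x3).

(* The coefficients of [comb3] sum to zero, so the constant [1] of the kernel drops out. *)
Lemma comb3_norm_identity {M : Hilbert} (P : C -> Prop) (f : C -> C) (u w : C -> M)
  (Hk : forall a b, P a -> P b ->
          hinner M (u a) (u b) = 1 - Cconj (f b) * f a + hinner M (w a) (w b))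
  (p1 p2 p3 k1 k2 : C) : P p1 -> P p2 -> P p3 ->
  (Cmod (k1 * f p1 + k2 * f p2 - (k1 + k2) * f p3) ^ 2
   + norm (comb3 k1 k2 (u p1) (u p2) (u p3)) ^ 2
   = norm (comb3 k1 k2 (w p1) (w p2) (w p3)) ^ 2)%R.
Proof.
  intros H1 H2 H3.
  assert (E : RtoC (Cmod (k1 * f p1 + k2 * f p2 - (k1 + k2) * f p3) ^ 2)
              + hinner M (comb3 k1 k2 (u p1) (u p2) (u p3)) (comb3 k1 k2 (u p1) (u p2) (u p3))
            = hinner M (comb3 k1 k2 (w p1) (w p2) (w p3)) (comb3 k1 k2 (w p1) (w p2) (w p3))).
  { rewrite Cmod2_conj. unfold comb3. autorewrite with hinner.
    repeat rewrite Hk by assumption.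
    autorewrite with Cconj. ring. }
  rewrite !hinner_self in E. apply (f_equal Re) in E. simpl in E. lra.
Qed.

Section Realization.

Variables (delta : R) (f : C -> C) (M : Hilbert) (U : M -> M) (u : C -> M).
Hypothesis hdelta : (0 < delta < 1)%R.
Hypothesis hU : unitary M U.
Hypothesis hf : forall lam mu : C, G delta lam -> G delta mu ->
  Cminus (RtoC 1) (Cmult (Cconj (f mu)) (f lam)) =
  hinner M (minus (u lam) (adj M (lamU M delta U mu) (lamU M delta U lam (u lam)))) (u mu).

Local Notation V := (adj M U).
Local Notation z lam := (resolvent U lam (u lam)).
Local Notation w lam := (lamU M delta U lam (u lam)).

Let V_hinner_l := hinner_adj_l U (unitary_has_adjoint U hU).

Lemma u_resolvent (lam : C) : G delta lam -> u lam = minus (z lam) (scal (half lam) (V (z lam))).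
Proof.
  intros Hlam. symmetry. exact (resolvent_spec U lam hU (G_half_lt_1 delta lam hdelta Hlam) _).
Qed.

Lemma kernel_identity (a b : C) : G delta a -> G delta b ->
  hinner M (u a) (u b) = 1 - Cconj (f b) * f a + hinner M (w a) (w b).
Proof.
  intros Ha Hb. pose proof (hf a b Ha Hb) as H.
  rewrite hinner_minus_l,
    (hinner_adj_l _ (lamU_has_adjoint U delta b hU (G_half_lt_1 delta b hdelta Hb))) in H.
  replace (hinner M (u a) (u b))
    with ((hinner M (u a) (u b) - hinner M (w a) (w b)) + hinner M (w a) (w b)) by ring.
  rewrite <- H. unfold Cminus. ring.
Qed.

Section AtPoint.

Variables (z0 : C) (r : R).
Hypothesis Hz0 : G delta z0.
Hypothesis hr : (0 <= r < 1)%R.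
Hypothesis contraction : forall Z : M,
  (norm (minus (scal (RtoC delta) (V Z)) (scal (half z0) Z))
   <= r * norm (minus Z (scal (half z0) (V Z))))%R.

(* With [e] collecting the deviation of the coefficients [half p] from the frozen [half z0],
   the [u]- and [w]-combinations are [(1 - c0 V) Z - V e] and [(delta V - c0) Z - e]. *)
Lemma combination_estimates (p1 p2 k1 k2 : C) : G delta p1 -> G delta p2 ->
  let Z := comb3 k1 k2 (z p1) (z p2) (z z0) in
  let e := plus (scal (k1 * (half p1 - half z0)) (z p1)) (scal (k2 * (half p2 - half z0)) (z p2)) in
  (norm (minus Z (scal (half z0) (V Z))) <= 2 * norm e / (1 - r) /\
   Cmod (k1 * f p1 + k2 * f p2 - (k1 + k2) * f z0)
     <= r * norm (minus Z (scal (half z0) (V Z))) + norm e)%R.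
Proof.
  intros H1 H2 Z e.
  pose proof (comb3_norm_identity (G delta) f u (fun l => w l) kernel_identity
                p1 p2 z0 k1 k2 H1 H2 Hz0) as Hid.
  assert (Eu : comb3 k1 k2 (u p1) (u p2) (u z0)
               = minus (minus Z (scal (half z0) (V Z))) (V e)).
  { rewrite (u_resolvent p1 H1), (u_resolvent p2 H2), (u_resolvent z0 Hz0).
    apply hinner_ext_l. intros y. unfold Z, e, comb3.
    autorewrite with hinner. rewrite !V_hinner_l. autorewrite with hinner. ring. }
  assert (Ew : comb3 k1 k2 (w p1) (w p2) (w z0)
               = minus (minus (scal (RtoC delta) (V Z)) (scal (half z0) Z)) e).
  { rewrite !lamU_resolvent.
    apply hinner_ext_l. intros y. unfold Z, e, comb3.
    autorewrite with hinner. rewrite !V_hinner_l. autorewrite with hinner. ring. }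
  rewrite Eu, Ew in Hid.
  apply (pythagoras_estimates _ _ _ _ _ _ (Cmod_ge_0 _) (norm_ge_0 _) (norm_ge_0 _) hr Hid).
  - pose proof (Rle_trans _ _ _ (Rle_abs _) (norm_triangle_inv
      (minus Z (scal (half z0) (V Z))) (V e))).
    rewrite (isometry_norm V (unitary_adj_hinner U hU)) in H. exact H.
  - eapply Rle_trans; [exact (norm_minus_le _ e)|].
    apply Rplus_le_compat_r, contraction.
Qed.

Lemma resolvent_increment_bound (l : C) : G delta l ->
  ((1 - Cmod (half z0)) * norm (minus (z l) (z z0)) <= Cmod (l - z0) / (1 - r) * norm (z l))%R.
Proof.
  intros Gl.
  pose proof (combination_estimates l z0 1 (-1) Gl Hz0) as Hest. cbv zeta in Hest.
  destruct Hest as [Hest _].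
  replace (comb3 1 (-1) (z l) (z z0) (z z0)) with (minus (z l) (z z0)) in Hest
    by (unfold comb3; hinner_ring).
  replace (plus (scal (1 * (half l - half z0)) (z l)) (scal (-1 * (half z0 - half z0)) (z z0)))
    with (scal (half l - half z0) (z l)) in Hest by hinner_ring.
  eapply Rle_trans;
    [exact (norm_minus_scal_isometry_ge V (unitary_adj_hinner U hU) (half z0) _)|].
  eapply Rle_trans; [exact Hest|].
  pose proof (@norm_scal C_AbsRing M (half l - half z0) (z l)) as Hscal.
  change (abs (half l - half z0)) with (Cmod (half l - half z0)) in Hscal.
  rewrite Cmod_half_minus in Hscal.
  replace (Cmod (l - z0) / (1 - r) * norm (z l))%R
    with (2 * (Cmod (l - z0) / 2 * norm (z l)) / (1 - r))%R by (field; lra).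
  unfold Rdiv. apply Rmult_le_compat_r; [apply Rlt_le, Rinv_0_lt_compat; lra|].
  apply Rmult_le_compat_l; [lra | exact Hscal].
Qed.

Lemma resolvent_lipschitz : exists rho K, (0 < rho)%R /\
  forall l, (Cmod (l - z0) < rho)%R ->
    G delta l /\ (norm (minus (z l) (z z0)) <= K * Cmod (l - z0))%R.
Proof.
  destruct (G_open_ball delta z0 hdelta Hz0) as [rhoG [HrhoG HG]].
  pose proof (G_half_lt_1 delta z0 hdelta Hz0) as Hc0.
  set (Ka := (2 / ((1 - r) * (1 - Cmod (half z0))))%R).
  assert (HKa : (0 < Ka)%R).
  { apply Rdiv_lt_0_compat; [lra | apply Rmult_lt_0_compat; lra]. }
  exists (Rmin rhoG (/ (Ka + 1))), (Ka * norm (z z0))%R.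
  split; [apply Rmin_pos; [easy | apply Rinv_0_lt_compat; lra]|].
  intros l Hl.
  assert (Gl : G delta l) by (apply HG; eapply Rlt_le_trans; [exact Hl | apply Rmin_l]).
  split; [exact Gl|].
  pose proof (resolvent_increment_bound l Gl) as Hinc.
  assert (Hzl : (norm (z l) <= norm (minus (z l) (z z0)) + norm (z z0))%R).
  { replace (z l) with (plus (minus (z l) (z z0)) (z z0)) at 1 by hinner_ring.
    exact (@norm_triangle C_AbsRing M _ _). }
  set (d := norm (minus (z l) (z z0))) in *.
  set (n0 := norm (z z0)) in *.
  set (h := Cmod (l - z0)) in *.
  assert (Hd0 : (0 <= d)%R) by apply norm_ge_0.
  assert (Hn0 : (0 <= n0)%R) by apply norm_ge_0.
  assert (Hh0 : (0 <= h)%R) by apply Cmod_ge_0.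
  assert (Hh : (Ka * h <= 1)%R).
  { assert (Hh1 : (h < / (Ka + 1))%R) by (eapply Rlt_le_trans; [exact Hl | apply Rmin_r]).
    apply Rmult_lt_compat_l with (r := (Ka + 1)%R) in Hh1; [|lra].
    rewrite Rinv_r in Hh1 by lra. nra. }
  assert (Hd : (d <= Ka * h / 2 * (d + n0))%R).
  { apply Rmult_le_reg_l with (r := (1 - Cmod (half z0))%R); [lra|].
    eapply Rle_trans; [exact Hinc|].
    replace ((1 - Cmod (half z0)) * (Ka * h / 2 * (d + n0)))%R
      with (h / (1 - r) * (d + n0))%R by (unfold Ka; field; lra).
    apply Rmult_le_compat_l; [apply Rdiv_le_0_compat; lra | exact Hzl]. }
  nra.
Qed.

Lemma diff_quot_cauchy_bound : exists rho K, (0 < rho)%R /\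
  forall l l', (0 < Cmod (l - z0) < rho)%R -> (0 < Cmod (l' - z0) < rho)%R ->
    (Cmod (diff_quot f z0 l - diff_quot f z0 l') <= K * (Cmod (l - z0) + Cmod (l' - z0)))%R.
Proof.
  destruct resolvent_lipschitz as (rho & Kz & Hrho & Hlip).
  exists rho, ((2 * r / (1 - r) + 1) * (Kz / 2))%R. split; [exact Hrho|].
  intros l l' Hl Hl'.
  destruct (Hlip l (proj2 Hl)) as [Gl Hd]. destruct (Hlip l' (proj2 Hl')) as [Gl' Hd'].
  assert (Hn : l - z0 <> 0) by (apply Cmod_gt_0; lra).
  assert (Hn' : l' - z0 <> 0) by (apply Cmod_gt_0; lra).
  pose proof (combination_estimates l l' (/ (l - z0)) (- / (l' - z0)) Gl Gl') as Hest.
  cbv zeta in Hest. destruct Hest as [Ha HF].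
  replace (/ (l - z0) * f l + - / (l' - z0) * f l' - (/ (l - z0) + - / (l' - z0)) * f z0)
    with (diff_quot f z0 l - diff_quot f z0 l') in HF by (unfold diff_quot; field; auto).
  replace (/ (l - z0) * (half l - half z0)) with (RtoC (/ 2)) in Ha, HF
    by (unfold half; field; repeat split; auto; intros H; injection H; lra).
  replace (- / (l' - z0) * (half l' - half z0)) with (- RtoC (/ 2)) in Ha, HF
    by (unfold half; field; repeat split; auto; intros H; injection H; lra).
  replace (plus (scal (RtoC (/ 2)) (z l)) (scal (- RtoC (/ 2)) (z l')))
    with (minus (scal (RtoC (/ 2)) (minus (z l) (z z0))) (scal (RtoC (/ 2)) (minus (z l') (z z0))))
    in Ha, HF by hinner_ring.
  set (e := minus (scal (RtoC (/ 2)) (minus (z l) (z z0))) (scal (RtoC (/ 2)) (minus (z l') (z z0))))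
    in Ha, HF.
  assert (He : (norm e <= Kz / 2 * (Cmod (l - z0) + Cmod (l' - z0)))%R).
  { eapply Rle_trans; [exact (norm_minus_le _ _)|].
    pose proof (@norm_scal C_AbsRing M (RtoC (/ 2)) (minus (z l) (z z0))) as H1.
    pose proof (@norm_scal C_AbsRing M (RtoC (/ 2)) (minus (z l') (z z0))) as H2.
    change (abs (RtoC (/ 2))) with (Cmod (RtoC (/ 2))) in H1, H2.
    rewrite Cmod_R, Rabs_pos_eq in H1, H2 by lra.
    eapply Rle_trans; [apply Rplus_le_compat; [exact H1 | exact H2]|]. nra. }
  assert (Hr2 : (0 <= 2 * r / (1 - r))%R) by (apply Rdiv_le_0_compat; lra).
  eapply Rle_trans; [exact HF|].
  eapply Rle_trans; [apply Rplus_le_compat_r, Rmult_le_compat_l; [lra | exact Ha]|].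
  replace (r * (2 * norm e / (1 - r)) + norm e)%R with ((2 * r / (1 - r) + 1) * norm e)%R
    by (field; lra).
  rewrite Rmult_assoc. apply Rmult_le_compat_l; [lra | exact He].
Qed.

End AtPoint.

End Realization.

Local Close Scope C_scope.

Theorem proposition2p9 (delta : R) (hdelta : 0 < delta < 1) (f : C -> C)
  (M : Hilbert) (U : M -> M) (hU : unitary M U) (u : C -> M)
  (hf : forall lam mu : C, G delta lam -> G delta mu ->
     Cminus (RtoC 1) (Cmult (Cconj (f mu)) (f lam)) =
     hinner M (minus (u lam) (adj M (lamU M delta U mu) (lamU M delta U lam (u lam))))
              (u mu)) :
  holomorphic_on (G delta) f.
Proof.
  intros z0 Hz0.
  destruct (lamU_contraction delta (half z0) hdelta (G_half_ellipse delta z0 hdelta Hz0))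
    as [r [hr contraction]].
  destruct (diff_quot_cauchy_bound delta f M U u hdelta hU hf z0 r Hz0 hr
              (contraction M (adj M U) (unitary_adj_hinner U hU)))
    as (rho & K & Hrho & HD).
  destruct (diff_quot_cvg f z0 rho K Hrho HD) as [L HL].
  exists L. exact (is_derive_of_diff_quot_cvg f z0 L HL).
Qed.
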